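(* Let $m\ge 2$, $n\ge1$, and let $\mathcal T\in\mathbb T(\mathbb C^n,m)$ be generic. Then for every $\lambda\in\sigma(\mathcal T)$ the eigenvariety $V(\lambda)$ has dimension one and is irreducible, i.e., $\mathcal T$ has a unique (up to scaling) eigenvector for every $\lambda\in\sigma(\mathcal T)$.
   Context: $\mathbb T(\mathbb C^n,m)=\otimes^m\mathbb C^n$ is the space of $m$-th order $n$-dimensional complex tensors $\mathcal T=(t_{i_1\ldots i_m})$. ''Generic'' means that the assertion holds for all $\mathcal T$ in some nonempty Zariski open subset of $\mathbb T(\mathbb C^n,m)$. For $\mathbf x\in\mathbb C^n$, $\mathcal T\mathbf x^{m-1}\in\mathbb C^n$ has $i$-th entry $\sum_{i_2,\dots,i_m=1}^n t_{ii_2\ldots i_m}x_{i_2}\cdots x_{i_m}$, and $\mathbf x^{[m-1]}$ has $i$-th entry $x_i^{m-1}$. A number $\lambda\in\mathbb C$ is an eigenvalue of $\mathcal T$ if there is $\mathbf x\neq\mathbf 0$ (an eigenvector) with $\mathcal T\mathbf x^{m-1}=\lambda\mathbf x^{[m-1]}$; $\sigma(\mathcal T)$ is the set of eigenvalues. The eigenvariety is $V(\lambda)=\{\mathbf x\in\mathbb C^n:\mathcal T\mathbf x^{m-1}=\lambda\mathbf x^{[m-1]}\}$ (with $\mathbf 0$ included), regarded as an affine variety in $\mathbb C^n$; dimension and irreducibility refer to this affine variety (as a set). *)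

(* Defs.v *)
From HB Require Import structures.
From mathcomp Require Export all_boot all_order all_algebra.
From mathcomp Require Export complex mpoly.
From mathcomp Require Export boolp classical_sets reals.

Set Implicit Arguments.
Unset Strict Implicit.
Unset Printing Implicit Defensive.

Import GRing.Theory.
Local Open Scope classical_set_scope.
Local Open Scope ring_scope.

(* The affine space with coordinates indexed by a finite type I is
   {ffun I -> F}; its polynomial functions are given by {mpoly F[#|I|]}, the
   k-th variable being the coordinate of index enum_val k. *)
Definition eval_at (F : fieldType) (I : finType)
    (p : {mpoly F[#|I|]}) (x : {ffun I -> F}) : F :=
  p.@[fun k => x (enum_val k)].

Definition zariski_closed (F : fieldType) (I : finType)
    (A : set {ffun I -> F}) : Prop :=
  exists S : set {mpoly F[#|I|]},
    A = [set x | forall p, S p -> eval_at p x = 0].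

Definition zariski_open (F : fieldType) (I : finType)
    (U : set {ffun I -> F}) : Prop :=
  zariski_closed (~` U).

Definition zariski_irreducible (F : fieldType) (I : finType)
    (V : set {ffun I -> F}) : Prop :=
  V !=set0 /\
  forall A B : set {ffun I -> F}, zariski_closed A -> zariski_closed B ->
    V `<=` A `|` B -> V `<=` A \/ V `<=` B.

(* Z 0 `<` Z 1 `<` ... `<` Z d; the values of Z beyond d are irrelevant. *)
Definition irreducible_chain (F : fieldType) (I : finType)
    (V : set {ffun I -> F}) (d : nat) (Z : nat -> set {ffun I -> F}) : Prop :=
  (forall i, (i <= d)%N ->
     [/\ zariski_closed (Z i), zariski_irreducible (Z i) & Z i `<=` V]) /\
  (forall i, (i < d)%N -> Z i `<` Z i.+1).

(* Krull dimension; meant for a Zariski closed V. *)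
Definition has_dimension (F : fieldType) (I : finType)
    (V : set {ffun I -> F}) (d : nat) : Prop :=
  (exists Z, irreducible_chain V d Z) /\
  (forall e Z, irreducible_chain V e Z -> (e <= d)%N).

Definition generic (F : fieldType) (I : finType)
    (P : {ffun I -> F} -> Prop) : Prop :=
  exists U : set {ffun I -> F},
    [/\ zariski_open U, U !=set0 & forall x, U x -> P x].

Definition tensor (F : fieldType) (n m : nat) := {ffun m.-tuple 'I_n -> F}.

(* The sum runs over the multi-indices t = (i_1, ..., i_m) with i_1 = i; for
   m > 0 these correspond to the (m-1)-tuples (i_2, ..., i_m). *)
Definition tensor_apply (F : fieldType) (n m : nat)
    (T : tensor F n m) (x : {ffun 'I_n -> F}) : {ffun 'I_n -> F} :=
  [ffun i => \sum_(t : m.-tuple 'I_n | ohead t == Some i)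
               T t * \prod_(j <- behead t) x j].

Definition power_vec (F : fieldType) (n k : nat)
    (x : {ffun 'I_n -> F}) : {ffun 'I_n -> F} :=
  [ffun i => x i ^+ k].

Definition scale_vec (F : fieldType) (n : nat)
    (c : F) (x : {ffun 'I_n -> F}) : {ffun 'I_n -> F} :=
  [ffun i => c * x i].

Definition eigenvariety (F : fieldType) (n m : nat)
    (T : tensor F n m) (lambda : F) : set {ffun 'I_n -> F} :=
  [set x | tensor_apply T x = scale_vec lambda (power_vec m.-1 x)].

Definition eigenvector (F : fieldType) (n m : nat)
    (T : tensor F n m) (lambda : F) (x : {ffun 'I_n -> F}) : Prop :=
  x <> 0 /\ tensor_apply T x = scale_vec lambda (power_vec m.-1 x).

Definition spectrum (F : fieldType) (n m : nat) (T : tensor F n m) : set F :=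
  [set lambda | exists x, eigenvector T lambda x].

(* Main.v *)
(* If x, y are non-proportional eigenvectors of T for the same lambda, normalised
   by x_a = 1 and y_c = 1, then some 2x2 minor of their monomials of degree m - 1
   is nonzero, so the equations determine 2n entries of T from the other entries,
   lambda, x and y. Hence the N = n^m entries of such a T are rational functions of
   N - 2n + 1 + 2(n - 1) = N - 1 parameters, so T is a zero of a nonzero
   polynomial. Off the zeros of these finitely many polynomials, one per choice of
   a, c and the minor, each eigenvariety is a line. *)
Require Import Defs.
From mathcomp Require Import zify ring.

Set Implicit Arguments.
Unset Strict Implicit.
Unset Printing Implicit Defensive.

Import GRing.Theory Num.Theory.
Local Open Scope classical_set_scope.
Local Open Scope ring_scope.

(** * Points where a nonzero polynomial does not vanish *)

Lemma poly_nonroot (F : numFieldType) (p : {poly F}) :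
  p != 0 -> exists c, p.[c] != 0.
Proof.
move=> p0; apply: contrapT => nc.
(* Characteristic zero makes these [size p] elements distinct, one more than the degree of [p]
   allows as roots. *)
pose rs : seq F := [seq i%:R | i <- iota 0 (size p)].
have ur : uniq rs by rewrite map_inj_uniq ?iota_uniq//; exact: (mulrIn (oner_neq0 F)).
have ar : all (root p) rs.
  by apply/allP => x _; apply/rootP/eqP/negPn/negP => px; apply: nc; exists x.
by have := max_poly_roots p0 ar ur; rewrite size_map size_iota ltnn.
Qed.

(** Uniqueness of base [D] expansions: the residue modulo [D] gives the lowest digit, and induction
    gives the others. *)
Lemma digits_inj D n (a b : 'I_n -> nat) :
  (forall i, a i < D)%N -> (forall i, b i < D)%N ->
  (\sum_i a i * D ^ i = \sum_i b i * D ^ i)%N -> a =1 b.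
Proof.
elim: n a b => [|n IH] a b aD bD; first by move=> _ [].
have split_low (f : 'I_n.+1 -> nat) : (\sum_i f i * D ^ i =
    (\sum_(i < n) f (lift ord0 i) * D ^ i) * D + f ord0)%N.
  rewrite big_ord_recl expn0 muln1 addnC big_distrl /=; congr (_ + _)%N.
  by apply: eq_bigr => i _; rewrite /bump add1n expnSr mulnA.
rewrite !split_low => E.
have E0 : a ord0 = b ord0.
  by move/(congr1 (modn^~ D)): E; rewrite !modnMDl !modn_small.
move: E; rewrite E0 => /addIn/eqP; rewrite eqn_pmul2r; last first.
  exact: leq_ltn_trans (aD ord0).
move=> /eqP/IH H i; case: (unliftP ord0 i) => [j|] -> //.
by apply: (H _ _ j).
Qed.

(* Kronecker substitution [X_i := t ^ (D ^ i)] with [D] above all exponents. *)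
Lemma mpoly_nonzero_point (F : numFieldType) n (p : {mpoly F[n]}) :
  p != 0 -> exists v, p.@[v] != 0.
Proof.
move=> p0; pose D := msize p; pose phi (m : 'X_{1..n}) := (\sum_i m i * D ^ i)%N.
have mD m i : m \in msupp p -> (m i < D)%N.
  move=> /msize_mdeg_lt; apply: leq_ltn_trans.
  by rewrite mdegE (bigD1 i)//= leq_addr.
pose q : {poly F} := \sum_(m <- msupp p) p@_m *: 'X^(phi m).
(* By uniqueness of digits [phi] separates the monomials of [p], so the coefficient of [q] at
   [phi (mlead p)] is the leading coefficient of [p]. *)
have q0 : q != 0.
  apply/eqP => /(congr1 (fun r : {poly F} => r`_(phi (mlead p)))).
  have lp : mlead p \in msupp p by exact: mlead_supp.
  rewrite coef0 coef_sum (bigD1_seq (mlead p)) ?msupp_uniq//=.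
  rewrite coefZ coefXn eqxx mulr1 big_seq_cond big1 ?addr0.
    by move/eqP; rewrite mleadc_eq0 (negPf p0).
  move=> m /andP[mp mn]; rewrite coefZ coefXn; case: eqP => [E|_]; last by rewrite mulr0.
  case/eqP: mn; apply/mnmP => i.
  by rewrite (@digits_inj D _ (mlead p) m)// => j; exact: mD.
have [t qt] := poly_nonroot q0.
exists (fun i => t ^+ (D ^ i)); move: qt; congr (_ != 0).
rewrite mevalE horner_sum; apply: eq_bigr => m _.
rewrite hornerZ hornerXn; congr (_ * _).
rewrite /phi -prodrXr; apply: eq_bigr => i _.
by rewrite -exprM mulnC.
Qed.

(** * Degree bounds and algebraic dependence of fractions *)

(** Each exponent of a multi-index of degree below [b] is itself below [b]; this crude count
    suffices for the dimension argument. *)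
Lemma card_bmultinom n b : (#|{: 'X_{1..n < b}}| <= b ^ n)%N.
Proof.
have mb (m : 'X_{1..n < b}) i : (m i < b)%N.
  by apply: leq_ltn_trans (bmdeg m); rewrite mdegE (bigD1 i)//= leq_addr.
pose f m : {ffun 'I_n -> 'I_b} := [ffun i => Ordinal (mb m i)].
have /leq_card : injective f.
  move=> m m' /ffunP E; apply/val_inj/mnmP => i.
  by have /(congr1 val) := E i; rewrite !ffunE.
by rewrite card_ffun !card_ord.
Qed.

Section Degrees.
Variables (F : fieldType) (k : nat).
Implicit Types p q : {mpoly F[k]}.

(** As [msize] is the degree plus one, and 0 for the zero polynomial, bounds of the form [a.+1] say
    that the degree is at most [a] and cover zero as well. *)
Lemma msizeM_bound p q a b :
  (msize p <= a.+1)%N -> (msize q <= b.+1)%N -> (msize (p * q) <= (a + b).+1)%N.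
Proof.
have [->|p0] := eqVneq p 0; first by rewrite mul0r msize0.
have [->|q0] := eqVneq q 0; first by rewrite mulr0 msize0.
rewrite msizeM//; move: (msize p) (msize q) => u v; lia.
Qed.

Lemma msizeX_bound p a n : (msize p <= a.+1)%N -> (msize (p ^+ n) <= (n * a).+1)%N.
Proof.
move=> pa; elim: n => [|n IH]; first by rewrite expr0 msize1.
by rewrite exprS mulSn; exact: msizeM_bound.
Qed.

Lemma msize_prod_bound n (f : 'I_n -> {mpoly F[k]}) a :
  (forall i, msize (f i) <= a.+1)%N -> (msize (\prod_i f i) <= (n * a).+1)%N.
Proof.
elim: n f => [|n IH] f fa; first by rewrite big_ord0 msize1.
by rewrite big_ord_recl mulSn; apply: msizeM_bound => //; apply: IH.
Qed.

(** The coefficient matrix has more rows than columns, so its left kernel contains a nonzero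
    vector. *)
Lemma mpoly_linear_dependent (I : finType) b (M : I -> {mpoly F[k]}) :
  (b ^ k < #|I|)%N -> (forall i, msize (M i) <= b)%N ->
  exists2 c : I -> F, (exists i, c i != 0) & \sum_i c i *: M i = 0.
Proof.
move=> bI Mb; pose X := {: 'X_{1..k < b}}.
pose A := \matrix_(r < #|I|, s < #|X|) (M (enum_val r))@_(enum_val s : 'X_{1..k < b}).
have : kermx A != 0.
  rewrite kermx_eq0 /row_free; apply/eqP => rA.
  have := rank_leq_col A; rewrite rA leqNgt.
  by rewrite (leq_ltn_trans (card_bmultinom k b) bI).
move=> /rowV0Pn[u /sub_kermxP uA /rV0Pn[j uj]].
exists (fun i => u ord0 (enum_rank i)); first by exists (enum_val j); rewrite enum_valK.
apply/mpolyP => m; rewrite mcoeff0 raddf_sum /=.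
have [bm|mb] := leqP b (mdeg m).
  apply: big1 => i _; rewrite mcoeffZ [X in _ * X](_ : _ = 0) ?mulr0//.
  by apply/eqP; rewrite mcoeff_eq0 msize_mdeg_ge// (leq_trans (Mb i)).
have := congr1 (fun B : 'rV_#|X| => B ord0 (enum_rank (BMultinom mb : X))) uA.
rewrite !mxE => E; rewrite -[RHS]E (reindex_onto enum_val enum_rank) /=; last first.
  by move=> i _; rewrite enum_rankK.
apply: eq_big => [r|r _]; first by rewrite enum_valK eqxx.
by rewrite mcoeffZ !mxE enum_valK enum_rankK.
Qed.

End Degrees.

(* Counting dimensions: the [D ^ #|J|] products [h ^+ (D-1) * (g / h) ^ e] with
   exponents below [D] have degree [O(D)] in [k] variables, so they are linearly
   dependent for large [D]. *)
Lemma fractions_algebraic_dependent (F : fieldType) (J : finType) k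
    (h : {mpoly F[k]}) (g : J -> {mpoly F[k]}) : (k < #|J|)%N ->
  exists2 P : {mpoly F[#|J|]}, P != 0 &
    forall (T : {ffun J -> F}) v, h.@[v] != 0 ->
      (forall j, h.@[v] * T j = (g j).@[v]) -> eval_at P T = 0.
Proof.
move=> kJ; set N := #|J| in kJ *.
pose d := (msize h + \sum_j msize (g j))%N.
have hd : (msize h <= d.+1)%N by rewrite /d; lia.
have gd j : (msize (g j) <= d.+1)%N by rewrite /d (bigD1 j)//=; lia.
(* With [C.+1] for the [D] above, [b <= (N * d).+1 * C.+1] gives [b ^ k <= C * C.+1 ^ k < C.+1 ^
   k.+1 <= C.+1 ^ N], the number of exponent vectors; the last inequality is [k < N]. *)
pose C := ((N * d).+1 ^ k)%N.
pose E := {ffun 'I_N -> 'I_C.+1}.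
pose M (e : E) := \prod_i (h ^+ (C - e i) * g (enum_val i) ^+ e i).
pose b := (N * (C * d)).+1.
have Mb e : (msize (M e) <= b)%N.
  apply: msize_prod_bound => i.
  have -> : (C * d = (C - e i) * d + e i * d)%N.
    by rewrite -mulnDl subnK// -ltnS.
  by apply: msizeM_bound; apply: msizeX_bound.
have cE : (b ^ k < #|{: E}|)%N.
  rewrite card_ffun !card_ord.
  apply: (@leq_trans (C.+1 ^ k.+1)); last by rewrite leq_exp2l//; lia.
  apply: (@leq_ltn_trans (C * C.+1 ^ k)); last by rewrite expnS ltn_mul2r expn_gt0/=.
  have bC : (b <= (N * d).+1 * C.+1)%N by rewrite /b; nia.
  by rewrite -expnMn; case: (k) => // k'; rewrite leq_exp2r.
have [c [e0 ce0] cM] := mpoly_linear_dependent cE Mb.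
pose mon (e : E) : 'X_{1..N} := [multinom val (e i) | i < N].
have mon_inj : injective mon.
  move=> e e' /mnmP H; apply/ffunP => i; apply/val_inj.
  by have := H i; rewrite !mnmE.
exists (\sum_e c e *: 'X_[mon e]).
  apply/eqP => /(congr1 (mcoeff (mon e0))); rewrite mcoeff0 raddf_sum /=.
  rewrite (bigD1 e0)//= mcoeffZ mcoeffX eqxx mulr1 big1 ?addr0; first exact/eqP.
  by move=> e ne; rewrite mcoeffZ mcoeffX (inj_eq mon_inj) (negPf ne) mulr0.
move=> T v hv gT.
(* At [v] the relation [cM] is this power of [h] times the value of the new polynomial at [T], so
   the power can be cancelled. *)
have : h.@[v] ^+ (N * C) != 0 by rewrite expf_neq0.
move=> /mulfI; apply; move/(congr1 (meval v)): cM; rewrite meval0 mulr0 => cM.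
rewrite -[RHS]cM /eval_at !raddf_sum /=.
rewrite mulr_sumr; apply: eq_bigr => e _.
rewrite !mevalZ mulrCA; congr (_ * _).
rewrite mevalX rmorph_prod /= mulnC exprM -[X in _ ^+ X]card_ord
  -prodr_const -big_split /=.
apply: eq_bigr => i _.
rewrite mnmE rmorphM !rmorphXn /= -gT exprMn mulrA -exprD subnK//.
by rewrite -ltnS.
Qed.

(** * Polynomial functions and Zariski closed sets *)

(** A predicate on functions lets closedness follow from closure rules, without handling the
    enumeration of [I] by variables. *)
Definition polynomial_fun (F : fieldType) (I : finType) (f : {ffun I -> F} -> F) :=
  exists p : {mpoly F[#|I|]}, forall z, f z = eval_at p z.

Section PolynomialFun.
Variables (F : fieldType) (I : finType).
Implicit Types f g : {ffun I -> F} -> F.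

Lemma polynomial_fun_cst c : polynomial_fun (fun _ : {ffun I -> F} => c).
Proof. by exists c%:MP => z; rewrite /eval_at mevalC. Qed.

Lemma polynomial_fun_coord i : polynomial_fun (fun z : {ffun I -> F} => z i).
Proof. by exists 'X_(enum_rank i) => z; rewrite /eval_at mevalXU enum_rankK. Qed.

Lemma polynomial_funD f g :
  polynomial_fun f -> polynomial_fun g -> polynomial_fun (fun z => f z + g z).
Proof. by move=> [p fp] [q gq]; exists (p + q) => z; rewrite /eval_at mevalD fp gq. Qed.

Lemma polynomial_funM f g :
  polynomial_fun f -> polynomial_fun g -> polynomial_fun (fun z => f z * g z).
Proof. by move=> [p fp] [q gq]; exists (p * q) => z; rewrite /eval_at mevalM fp gq. Qed.

Lemma polynomial_funB f g :
  polynomial_fun f -> polynomial_fun g -> polynomial_fun (fun z => f z - g z).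
Proof. by move=> [p fp] [q gq]; exists (p - q) => z; rewrite /eval_at mevalB fp gq. Qed.

Lemma polynomial_funX f n : polynomial_fun f -> polynomial_fun (fun z => f z ^+ n).
Proof. by move=> [p fp]; exists (p ^+ n) => z; rewrite /eval_at rmorphXn /= fp. Qed.

Lemma polynomial_fun_sum (J : Type) (r : seq J) (P : pred J) (f : J -> {ffun I -> F} -> F) :
  (forall j, P j -> polynomial_fun (f j)) ->
  polynomial_fun (fun z => \sum_(j <- r | P j) f j z).
Proof.
move=> fP; elim: r => [|j r [p IH]].
  by exists 0 => z; rewrite big_nil /eval_at meval0.
have [Pj|nPj] := boolP (P j); last first.
  by exists p => z; rewrite big_cons (negPf nPj) IH.
by have [q fq] := fP j Pj; exists (q + p) => z; rewrite big_cons Pj IH fq /eval_at mevalD.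
Qed.

Lemma polynomial_fun_prod (J : Type) (r : seq J) (f : J -> {ffun I -> F} -> F) :
  (forall j, polynomial_fun (f j)) ->
  polynomial_fun (fun z => \prod_(j <- r) f j z).
Proof.
move=> fP; elim: r => [|j r [p IH]].
  by exists 1 => z; rewrite big_nil /eval_at meval1.
by have [q fq] := fP j; exists (q * p) => z; rewrite big_cons IH fq /eval_at mevalM.
Qed.

Lemma polynomial_fun_horner (q : {poly F}) f :
  polynomial_fun f -> polynomial_fun (fun z => q.[f z]).
Proof.
move=> fP; have [p E] : polynomial_fun (fun z => \sum_(i < size q) q`_i * f z ^+ i).
  apply: polynomial_fun_sum => i _.
  by apply: polynomial_funM; [exact: polynomial_fun_cst | exact: polynomial_funX].
by exists p => z; rewrite horner_coef E.
Qed.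

Lemma zariski_closed_zeros (J : Type) (f : J -> {ffun I -> F} -> F) :
  (forall j, polynomial_fun (f j)) -> zariski_closed [set z | forall j, f j z = 0].
Proof.
move=> fP; exists [set p | exists j, forall z, f j z = eval_at p z].
apply/seteqP; split=> z /= zf; first by move=> p [j <-].
by move=> j; have [p fp] := fP j; rewrite fp; apply: zf; exists j.
Qed.

Lemma zariski_closed_zero f : polynomial_fun f -> zariski_closed [set z | f z = 0].
Proof.
move=> fP; have := @zariski_closed_zeros unit (fun _ => f) (fun _ => fP).
by congr zariski_closed; apply/seteqP; split=> z /=; [apply; exact: tt | move=> ?].
Qed.

Lemma zariski_closed1 (x : {ffun I -> F}) : zariski_closed [set x].
Proof.
have -> : [set x] = [set z | forall i, z i - x i = 0].
  apply/seteqP; split=> z /= => [-> i|zx]; first by rewrite subrr.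
  by apply/ffunP => i; apply/eqP; rewrite -subr_eq0 zx.
apply: zariski_closed_zeros => i.
by apply: polynomial_funB; [exact: polynomial_fun_coord|exact: polynomial_fun_cst].
Qed.

Lemma zariski_irreducible1 (x : {ffun I -> F}) : zariski_irreducible [set x].
Proof.
split; first by exists x.
by move=> A B _ _ /(_ x erefl)[Ax|Bx]; [left|right] => y ->.
Qed.

End PolynomialFun.

(** * Lines through the origin: closedness, irreducibility, dimension *)

Definition line (F : fieldType) n (x : {ffun 'I_n -> F}) : set {ffun 'I_n -> F} :=
  [set y | exists c, y = scale_vec c x].

Section Line.
Variables (F : numFieldType) (n : nat) (x : {ffun 'I_n -> F}) (a : 'I_n).
Hypothesis xa : x a != 0.

Lemma zariski_closed_line : zariski_closed (line x).
Proof.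
(* Since [x a != 0], the minors involving the coordinate [a] already force [y = (y a / x a) x]. *)
have -> : line x = [set y | forall j, x a * y j - x j * y a = 0].
  apply/seteqP; split=> y /= => [[c -> j]|xy]; first by rewrite !ffunE; ring.
  exists (y a / x a); apply/ffunP => j; rewrite ffunE; apply: (mulfI xa).
  by rewrite (subr0_eq (xy j)); field.
apply: zariski_closed_zeros => j.
by apply: polynomial_funB; apply: polynomial_funM;
  (exact: polynomial_fun_coord || exact: polynomial_fun_cst).
Qed.

(** Some defining polynomial of [A] is nonzero at a point of the line; [r] is its pullback along
    [c |-> c x]. *)
Lemma line_restriction A : zariski_closed A -> ~ (line x `<=` A) ->
  exists2 r : {poly F}, r != 0 & forall c, A (scale_vec c x) -> r.[c] = 0.
Proof.
move=> [S ->] /existsNP[_ /not_implyP[[c0 ->]]] /= /existsNP[p /not_implyP[Sp pc0]].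
pose r : {poly F} := \sum_(m <- msupp p) p@_m *:
   \prod_(i < #|{: 'I_n}|) (x (enum_val i) *: 'X) ^+ m i.
have rE c : r.[c] = eval_at p (scale_vec c x).
  rewrite /eval_at mevalE horner_sum; apply: eq_bigr => m _.
  rewrite hornerZ horner_prod; congr (_ * _); apply: eq_bigr => i _.
  by rewrite horner_exp hornerZ hornerX ffunE mulrC.
exists r; last by move=> c /(_ p Sp); rewrite rE.
by apply/eqP => r0; apply: pc0; rewrite -rE r0 horner0.
Qed.

(** If neither closed set contains the line, a nonroot of the product of the two pullbacks is the
    parameter of a point outside both. *)
Lemma zariski_irreducible_line : zariski_irreducible (line x).
Proof.
split; first by exists (scale_vec 0 x), 0.
move=> A B cA cB AB; apply: contrapT => /not_orP[nA nB].
have [r r0 rA] := line_restriction cA nA.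
have [q q0 qB] := line_restriction cB nB.
have [c] := poly_nonroot (mulf_neq0 r0 q0); rewrite hornerM.
have [/rA ->|/qB ->] : A (scale_vec c x) \/ B (scale_vec c x) by apply: AB; exists c.
  by rewrite mul0r eqxx.
by rewrite mulr0 eqxx.
Qed.

(* A closed set [Z1] properly inside the line is given by a nonzero univariate
   [r]; splitting off from [r] the root of a point of [Z0] splits [Z1]. *)
Lemma no_chain_in_line Z0 Z1 : zariski_closed Z1 -> zariski_irreducible Z1 ->
  Z0 !=set0 -> Z0 `<` Z1 -> Z1 `<` line x -> False.
Proof.
move=> cZ1 [_ iZ1] [z0 Z0z0] [Z01 /existsNP[z1 /not_implyP[Z1z1 nZ0z1]]] [Z1l lZ1].
have [r r0 rZ1] := line_restriction cZ1 lZ1.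
have [c0 z0E] := Z1l _ (Z01 _ Z0z0).
have z1E := Z1l _ Z1z1.
have [k [q]] := multiplicity_XsubC r c0; rewrite r0 /= => qc0 rE.
have fP : polynomial_fun (fun z : {ffun 'I_n -> F} => z a / x a).
  by apply: polynomial_funM; [exact: polynomial_fun_coord|exact: polynomial_fun_cst].
have ratio c : scale_vec c x a / x a = c by rewrite ffunE mulfK.
have [|||H|H] := iZ1 [set z | z a / x a - c0 = 0] [set z | q.[z a / x a] = 0].
- by apply: zariski_closed_zero; apply: polynomial_funB => //; exact: polynomial_fun_cst.
- exact/zariski_closed_zero/polynomial_fun_horner.
- move=> z Z1z; have [c zE] := Z1l _ Z1z.
  have := rZ1 c; rewrite -zE => /(_ Z1z)/eqP.
  rewrite rE hornerM horner_exp hornerXsubC mulf_eq0 expf_eq0 => /orP[/eqP qc|/andP[_ /eqP cc]].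
    by right; rewrite /= zE ratio.
  by left; rewrite /= zE ratio.
- have [c1 z1c] := z1E; have /= := H _ Z1z1; rewrite z1c ratio => /subr0_eq cc.
  by apply: nZ0z1; rewrite z1c cc -z0E.
- have /= := H _ (Z01 _ Z0z0); rewrite z0E ratio => q0.
  by move/negP: qc0; apply; apply/rootP.
Qed.

(** The chain from the origin to the line has length one; in a longer chain [Z 1] would lie strictly
    between a nonempty set and the line. *)
Lemma has_dimension_line : has_dimension (line x) 1.
Proof.
split.
  exists (fun i => if i == 0%N then [set 0] else line x); split.
    move=> [|i] _ /=; split.
    - exact: zariski_closed1.
    - exact: zariski_irreducible1.
    - by move=> _ ->; exists 0; apply/ffunP => i; rewrite !ffunE mul0r.
    - exact: zariski_closed_line.
    - exact: zariski_irreducible_line.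
    - by [].
  move=> [|//] _ /=; split.
    by move=> _ ->; exists 0; apply/ffunP => i; rewrite !ffunE mul0r.
  move=> /(_ x) /= H; have x0 : x = 0.
    by apply: H; exists 1; apply/ffunP => i; rewrite ffunE mul1r.
  by move: xa; rewrite x0 ffunE eqxx.
move=> e Z [ZP Zlt]; rewrite leqNgt; apply/negP => e2.
have [_ [Z0 _] _] := ZP 0%N isT.
have [cZ1 iZ1 _] := ZP 1%N (ltnW e2).
have [_ _ Z2l] := ZP 2%N e2.
have [Z12 nZ12] := Zlt 1%N e2.
apply: (no_chain_in_line cZ1 iZ1 Z0 (Zlt 0%N (ltnW e2))); split.
  exact: subset_trans Z2l.
by move=> lZ1; apply: nZ12; apply: subset_trans lZ1.
Qed.

End Line.

(** * Monomials, their minors, and scaling *)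

Definition monomial_at (F : fieldType) n (x : {ffun 'I_n -> F}) (u : seq 'I_n) : F :=
  \prod_(j <- u) x j.

(* The minor on the columns [s], [s'] of the matrix whose rows list the
   monomials in [x] and in [y]. *)
Definition monomial_minor (F : fieldType) n (s s' : seq 'I_n) (x y : {ffun 'I_n -> F}) : F :=
  monomial_at x s * monomial_at y s' - monomial_at x s' * monomial_at y s.

Section Scaling.
Variables (F : fieldType) (n : nat).
Implicit Types (x y : {ffun 'I_n -> F}) (c d : F).

Lemma monomial_at_scale c x u :
  monomial_at (scale_vec c x) u = c ^+ size u * monomial_at x u.
Proof.
rewrite /monomial_at; elim: u => [|j u IH]; first by rewrite !big_nil mulr1.
by rewrite !big_cons IH ffunE exprS; ring.
Qed.

Lemma monomial_minor_scale m (s s' : m.-tuple 'I_n) c d x y :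
  monomial_minor s s' (scale_vec c x) (scale_vec d y) =
  (c * d) ^+ m * monomial_minor s s' x y.
Proof. by rewrite /monomial_minor !monomial_at_scale !size_tuple exprMn; ring. Qed.

(** Both sides of the eigenvalue equation are homogeneous of degree [m.-1]. *)
Lemma eigenvariety_scale m (T : tensor F n m) lambda c x :
  eigenvariety T lambda x -> eigenvariety T lambda (scale_vec c x).
Proof.
move=> /ffunP Tx; apply/ffunP => i; have := Tx i; rewrite !ffunE => E.
rewrite exprMn mulrCA -E mulr_sumr; apply: eq_bigr => t _.
by rewrite -!/(monomial_at _ _) monomial_at_scale size_behead size_tuple; ring.
Qed.

Lemma exists_coord_neq0 x : x != 0 -> exists a, x a != 0.
Proof.
move=> x0; apply: contrapT => nx; case/eqP: x0; apply/ffunP => a.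
by rewrite ffunE; apply/eqP/negPn/negP => xa; apply: nx; exists a.
Qed.

(** Suppose all minors vanish. Comparing the powers of [x a] and [x b] gives [y a != 0]; comparing
    index [a] taken [m.+1] times with [i] followed by [m] copies of [a] gives
    [x a * y i = x i * y a]. Positive degree matters, since in degree 0 every minor is 0. *)
Lemma monomial_minor_neq0 m x y : x != 0 -> y != 0 ->
  (forall c, c != 0 -> y <> scale_vec c x) ->
  exists s s' : m.+1.-tuple 'I_n, monomial_minor s s' x y != 0.
Proof.
move=> x0 y0 xy; apply: contrapT => no_minor.
have minor0 (s s' : m.+1.-tuple 'I_n) : monomial_minor s s' x y = 0.
  by apply/eqP/negPn/negP => h; apply: no_minor; exists s, s'.
have mon_nseq (z : {ffun 'I_n -> F}) b k : monomial_at z (nseq k b) = z b ^+ k.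
  by rewrite /monomial_at big_nseq iter_mulr_1.
have [a xa] := exists_coord_neq0 x0; have [b yb] := exists_coord_neq0 y0.
have ya : y a != 0.
  apply/eqP => ya0; have := minor0 [tuple of nseq m.+1 a] [tuple of nseq m.+1 b].
  rewrite /monomial_minor !mon_nseq ya0 expr0n mulr0 subr0 => /eqP.
  by rewrite mulf_eq0 !expf_eq0 (negPf xa) (negPf yb).
apply: (xy (y a / x a)); first by rewrite mulf_neq0 ?invr_eq0.
apply/ffunP => i; rewrite ffunE.
have := minor0 [tuple of a :: nseq m a] [tuple of i :: nseq m a].
rewrite /monomial_minor /monomial_at !big_cons -!/(monomial_at _ _) !mon_nseq => E.
apply: (mulfI (expf_neq0 m xa)); apply: (mulfI (expf_neq0 m ya)); apply: (mulfI xa).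
by rewrite -[RHS]addr0 -E; field.
Qed.

End Scaling.

(** * Tensors with two independent eigenvectors for one eigenvalue *)

(** Isolates two entries in row [i]. Written for both [x] and [y], it is a 2x2 linear system for
    these entries with determinant [monomial_minor s s' x y]. *)
Lemma eigen_row (F : fieldType) n m (T : tensor F n m.+1) lambda x i
    (s s' : m.-tuple 'I_n) : s != s' -> eigenvariety T lambda x ->
  lambda * x i ^+ m - \sum_(t : m.+1.-tuple 'I_n | [&& ohead t == Some i,
       behead t != s & behead t != s']) T t * monomial_at x (behead t) =
  T [tuple of i :: s] * monomial_at x s + T [tuple of i :: s'] * monomial_at x s'.
Proof.
move=> ss' /ffunP/(_ i); rewrite !ffunE => <-.
have consE (t : m.+1.-tuple 'I_n) (u : m.-tuple 'I_n) : ohead t == Some i ->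
    (t != [tuple of i :: u]) = (behead t != u).
  case/tupleP: t => j t /=; rewrite /ohead /= => /eqP[->].
  by rewrite -val_eqE /= eqseq_cons eqxx.
rewrite (bigD1 [tuple of i :: s])//= (bigD1 [tuple of i :: s'])/=; last first.
  by rewrite eqxx -val_eqE /= eqseq_cons eqxx eq_sym.
rewrite -!/(monomial_at _ _) addrA; apply/eqP; rewrite subr_eq; apply/eqP.
congr (_ + _); apply: eq_bigl => t.
by case h : (ohead t == Some i); rewrite //= !consE.
Qed.

(* Cramer's rule recovers the entries [(i, s)] and [(i, s')] of [T] from the other
   entries, [lambda], [x] and [y]. This leaves [2n] slots free: slot [(i, s)] stores
   [x i], slot [(a, s)] stores [lambda] since [x a = 1], slot [(i, s')] stores [y i],
   and slot [(c, s')] is not needed since [y c = 1]. *)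
Lemma bad_tensors_patch (F : fieldType) n m (a c : 'I_n) (s s' : m.-tuple 'I_n) :
  exists2 P : {mpoly F[#|{: m.+1.-tuple 'I_n}|]}, P != 0 &
    forall (T : tensor F n m.+1) lambda x y,
      eigenvariety T lambda x -> eigenvariety T lambda y ->
      x a = 1 -> y c = 1 -> monomial_minor s s' x y != 0 -> eval_at P T = 0.
Proof.
pose J := {: m.+1.-tuple 'I_n}; pose j0 : J := [tuple of c :: s'].
pose K := {: {t : J | t != j0}}.
pose ext (z : {ffun K -> F}) (t : J) : F := if insub t is Some k then z k else 0.
pose X z : {ffun 'I_n -> F} :=
  [ffun i => if i == a then 1 else ext z [tuple of i :: s]].
pose Y z : {ffun 'I_n -> F} :=
  [ffun i => if i == c then 1 else ext z [tuple of i :: s']].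
pose L z := ext z [tuple of a :: s].
pose A (W : {ffun K -> F} -> {ffun 'I_n -> F}) i z :=
  L z * W z i ^+ m - \sum_(t : m.+1.-tuple 'I_n | [&& ohead t == Some i,
       behead t != s & behead t != s']) ext z t * monomial_at (W z) (behead t).
pose h z := monomial_minor s s' (X z) (Y z).
(* Numerators over the common denominator [h]: Cramer's rule in the columns [s] and [s'], where
   [A X i] and [A Y i] are the right-hand sides of the system; elsewhere the stored entry times
   [h]. *)
pose g (t : J) z := let i := thead t in
  if behead t == s :> seq _ then
    A X i z * monomial_at (Y z) s' - A Y i z * monomial_at (X z) s'
  else if behead t == s' :> seq _ then
    A Y i z * monomial_at (X z) s - A X i z * monomial_at (Y z) s
  else h z * ext z t.
have extP t : polynomial_fun (ext^~ t).
  rewrite /ext; case: insubP => [k _ _|_]; first exact: polynomial_fun_coord.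
  exact: polynomial_fun_cst.
have XP i : polynomial_fun (fun z => X z i).
  have [p E] : polynomial_fun (fun z => if i == a then 1 else ext z [tuple of i :: s]).
    by case: (i == a) => //; exact: polynomial_fun_cst.
  by exists p => z; rewrite ffunE E.
have YP i : polynomial_fun (fun z => Y z i).
  have [p E] : polynomial_fun (fun z => if i == c then 1 else ext z [tuple of i :: s']).
    by case: (i == c) => //; exact: polynomial_fun_cst.
  by exists p => z; rewrite ffunE E.
have monP (W : {ffun K -> F} -> {ffun 'I_n -> F}) u :
    (forall i, polynomial_fun (fun z => W z i)) ->
    polynomial_fun (fun z => monomial_at (W z) u).
  by move=> WP; apply: polynomial_fun_prod.
have AP (W : {ffun K -> F} -> {ffun 'I_n -> F}) i :
    (forall i, polynomial_fun (fun z => W z i)) -> polynomial_fun (A W i).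
  move=> WP; apply: polynomial_funB.
    by apply: polynomial_funM; [exact: extP|exact: polynomial_funX].
  by apply: polynomial_fun_sum => t _; apply: polynomial_funM; [exact: extP|exact: monP].
have hP : polynomial_fun h.
  by apply: polynomial_funB; apply: polynomial_funM; exact: monP.
have gP t : polynomial_fun (g t).
  rewrite /g /=; case: (behead t == s :> seq _).
    by apply: polynomial_funB; apply: polynomial_funM; (exact: AP || exact: monP).
  case: (behead t == s' :> seq _); last exact: polynomial_funM hP (extP t).
  by apply: polynomial_funB; apply: polynomial_funM; (exact: AP || exact: monP).
have [ph hE] := hP; have [pg gE] := choice gP.
have KJ : (#|K| < #|J|)%N.
  by rewrite card_sig cardC1 prednK//; apply/card_gt0P; exists j0.
have [P P0 Pvanish] := fractions_algebraic_dependent ph pg KJ.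
exists P => // T lambda x y Tx Ty xa yc minor.
have ss' : s != s'.
  by apply: contra minor => /eqP ->; rewrite /monomial_minor mulrC subrr.
(* The point of parameter space belonging to [T], [lambda], [x], [y]: [w] fills the slots, [z] omits
   [j0], and [X], [Y], [L] read the data back. *)
pose w (t : J) := if behead t == s :> seq _ then
    (if thead t == a then lambda else x (thead t))
  else if behead t == s' :> seq _ then y (thead t) else T t.
pose z : {ffun K -> F} := [ffun k => w (val k)].
have extE t : t != j0 -> ext z t = w t.
  by move=> tj; rewrite /ext insubT ffunE.
have cons_neq i j (u v : m.-tuple 'I_n) : (i != j) || (u != v) ->
    [tuple of i :: u] != [tuple of j :: v].
  by move=> ?; rewrite -val_eqE /= eqseq_cons negb_and.
have XE : X z = x.
  apply/ffunP => i; rewrite ffunE; case: eqP => [->//|/eqP ia].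
  rewrite extE; last by rewrite cons_neq// ss' orbT.
  by rewrite /w /= eqxx theadE (negPf ia).
have YE : Y z = y.
  apply/ffunP => i; rewrite ffunE; case: eqP => [->//|/eqP ic].
  rewrite extE; last by rewrite cons_neq// ic.
  by rewrite /w /= val_eqE eq_sym (negPf ss') eqxx theadE.
have LE : L z = lambda.
  rewrite /L extE; last by rewrite cons_neq// ss' orbT.
  by rewrite /w /= eqxx theadE eqxx.
have AE (W : {ffun K -> F} -> {ffun 'I_n -> F}) i :
    eigenvariety T lambda (W z) -> A W i z =
    T [tuple of i :: s] * monomial_at (W z) s + T [tuple of i :: s'] * monomial_at (W z) s'.
  move=> TW; rewrite -(eigen_row i ss' TW) /A LE; congr (_ - _).
  apply: eq_bigr => t /and3P[_ ts ts']; rewrite extE.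
    by rewrite /w (negPf ts) (negPf ts').
  by apply: contra ts' => /eqP ->.
apply: (Pvanish T (fun k => z (enum_val k))).
  by rewrite -[_.@[_]]/(eval_at ph z) -hE /h XE YE.
move=> t; rewrite -![_.@[_]]/(eval_at _ z) -hE -gE /g /h XE YE.
rewrite !AE ?XE ?YE// /monomial_minor.
have tE (u : m.-tuple 'I_n) : behead t == u :> seq _ -> t = [tuple of thead t :: u].
  by move=> /eqP tu; apply/val_inj; rewrite /= -tu [in LHS](tuple_eta t).
case: ifP => [/tE {1}->|ts]; first by ring.
case: ifP => [/tE {1}->|ts']; first by ring.
rewrite extE; first by rewrite /w ts ts'.
by apply: contraFneq ts' => ->.
Qed.

(** * The generic tensor and its eigenvarieties *)

(** The open set is the nonvanishing locus of the product of the finitely many polynomials from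
    [bad_tensors_patch]; it is nonempty because this product is a nonzero polynomial in
    characteristic zero. *)
Lemma generic_unique_eigenvector (F : numFieldType) n m :
  generic (fun T : tensor F n m.+2 => forall lambda x y,
    eigenvector T lambda x -> eigenvector T lambda y ->
    exists c, c != 0 /\ y = scale_vec c x).
Proof.
pose I := ('I_n * 'I_n * (m.+1.-tuple 'I_n * m.+1.-tuple 'I_n))%type.
have /fin_all_exists2[P P0 PT] (i : I) :=
  @bad_tensors_patch F n m.+1 i.1.1 i.1.2 i.2.1 i.2.2.
pose Q := \prod_i P i.
have Q0 : Q != 0 by apply/prodf_neq0 => i _; exact: P0.
exists [set T | eval_at Q T != 0]; split.
- exists [set Q]; apply/seteqP; split=> T /=.
    by move=> /negP/negPn/eqP QT _ ->.
  by move=> /(_ Q erefl) ->; rewrite eqxx.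
- have [v Qv] := mpoly_nonzero_point Q0.
  exists [ffun t => v (enum_rank t)]; rewrite /= /eval_at.
  rewrite (@meval_eq _ _ _ v)// => k.
  by rewrite ffunE enum_valK.
move=> T /= QT lambda x y [/eqP x0 Tx] [/eqP y0 Ty]; apply: contrapT => nxy.
have [c c0 yx|s [s' minor]] := @monomial_minor_neq0 F n m x y x0 y0.
  by apply: nxy; exists c.
have [a xa] := exists_coord_neq0 x0; have [b yb] := exists_coord_neq0 y0.
(* Rescaling makes [x a] and [y b] equal to 1 and keeps the minor nonzero, so the factor of [Q]
   indexed by these choices vanishes at [T]. *)
case/negP: QT; rewrite /eval_at rmorph_prod /=.
rewrite (bigD1 ((a, b), (s, s')))//= -[X in X * _]/(eval_at _ T).
rewrite (PT _ T lambda (scale_vec (x a)^-1 x) (scale_vec (y b)^-1 y)) ?mul0r//=.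
- exact: eigenvariety_scale.
- exact: eigenvariety_scale.
- by rewrite ffunE mulVf.
- by rewrite ffunE mulVf.
- by rewrite monomial_minor_scale mulf_neq0// expf_neq0// mulf_neq0// invr_eq0.
Qed.

Theorem lemma6p3 (R : realType) (m n : nat) (hm : (2 <= m)%N) (hn : (1 <= n)%N) :
  generic (fun T : tensor R[i] n m =>
    forall lambda : R[i], spectrum T lambda ->
      [/\ has_dimension (eigenvariety T lambda) 1%N,
          zariski_irreducible (eigenvariety T lambda)
        & forall x y : {ffun 'I_n -> R[i]},
            eigenvector T lambda x -> eigenvector T lambda y ->
            exists c : R[i], c != 0 /\ y = scale_vec c x]).
Proof.
case: m hm => [|[|m]] // _.
have [U [oU U0 UT]] := generic_unique_eigenvector R[i] n m.
exists U; split=> // T /UT uniqT lambda [x Tx].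
have [/eqP/exists_coord_neq0[a xa] Vx] := Tx.
(* Uniqueness puts every nonzero point of the eigenvariety on the line; homogeneity gives the
   converse inclusion. *)
have VE : eigenvariety T lambda = line x.
  apply/seteqP; split=> [y Vy|_ [c ->]]; last exact: eigenvariety_scale.
  have [->|/eqP y0] := eqVneq y 0.
    by exists 0; apply/ffunP => i; rewrite !ffunE mul0r.
  by have [c [_ ->]] := uniqT lambda x y Tx (conj y0 Vy); exists c.
rewrite VE; split.
- exact: has_dimension_line xa.
- exact: zariski_irreducible_line.
- exact: uniqT.
Qed.
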